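(* Let $S\in\mathbb{Z}^{m\times n}$ and $u\in\mathbb{N}^m$ be such that $K_u:=\{x\in\mathbb{R}^n: Sx\le u\}$ satisfies $K_u\cap\mathbb{Z}^n=\{0\}$ and the removal of any one of the $m$ inequalities defining $K_u$ brings a non-zero lattice point (element of $\mathbb{Z}^n$) into the resulting relaxation. Let $s^{(i)}$ denote the $i$th row of $S$, let $M:=\max_i\|s^{(i)}\|_1$, and let $\Delta_n(S)$ and $\delta_n(S)$ be the maximum and the minimum, respectively, of the absolute values of the $n\times n$ subdeterminants of $S$. Assume $\delta_n(S)\ne 0$. Then for all $1\le i\le m$, $$0\le u_i\le 2M(n+2)\frac{\Delta_n(S)}{\delta_n(S)}.$$
   Context: $\mathbb{N}$ denotes the non-negative integers and $\|\cdot\|_1$ the sum of absolute values of the entries. *)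

(* Defs.v *)
From HB Require Import structures.
From mathcomp Require Export all_boot all_order all_algebra.
From mathcomp Require Export boolp classical_sets reals.
Set Implicit Arguments.
Unset Strict Implicit.
Unset Printing Implicit Defensive.
Import Order.TTheory GRing.Theory Num.Theory.
Local Open Scope classical_set_scope.
Local Open Scope ring_scope.

Definition satisfies (R : realType) (m n : nat) (S : 'M[int]_(m, n))
    (u : 'cV[nat]_m) (x : 'cV[R]_n) (i : 'I_m) : Prop :=
  (map_mx intr S *m x) i 0 <= (u i 0)%:R.

Definition polyhedron (R : realType) (m n : nat) (S : 'M[int]_(m, n))
    (u : 'cV[nat]_m) : set 'cV[R]_n :=
  [set x | forall i, satisfies S u x i].

(* Inequalities are indexed by rows: if two rows coincide, removing one of
   them leaves the other in place. *)
Definition relaxation (R : realType) (m n : nat) (S : 'M[int]_(m, n))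
    (u : 'cV[nat]_m) (k : 'I_m) : set 'cV[R]_n :=
  [set x | forall i, i != k -> satisfies S u x i].

Definition integer_lattice (R : realType) (n : nat) : set 'cV[R]_n :=
  range (fun z : 'cV[int]_n => map_mx intr z).
Arguments integer_lattice : clear implicits.

Definition max_row_norm1 (m n : nat) (S : 'M[int]_(m, n)) : nat :=
  \max_(i < m) \sum_(j < n) `|S i j|%N.

Definition increasing (m n : nat) (f : {ffun 'I_n -> 'I_m}) : bool :=
  [forall i : 'I_n, forall j : 'I_n, (i < j)%N ==> (f i < f j)%N].

(* S has exactly n columns, so an n x n submatrix amounts to a choice of n
   rows, encoded by the increasing enumeration f of the row indices. *)
Definition abs_subdet (m n : nat) (S : 'M[int]_(m, n))
    (f : {ffun 'I_n -> 'I_m}) : nat :=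
  `|\det (rowsub f S)|%N.

Definition max_subdet (m n : nat) (S : 'M[int]_(m, n)) : nat :=
  \max_(f : {ffun 'I_n -> 'I_m} | increasing f) abs_subdet S f.

(* The starting value [max_subdet S] bounds every term, so it does not affect
   the minimum; when m < n there is no term and both extrema are 0. *)
Definition min_subdet (m n : nat) (S : 'M[int]_(m, n)) : nat :=
  \big[minn/max_subdet S]_(f : {ffun 'I_n -> 'I_m} | increasing f)
    abs_subdet S f.

(* Main.v *)
Require Import Defs.
From mathcomp Require Import perm lra ring.
Set Implicit Arguments.
Unset Strict Implicit.
Unset Printing Implicit Defensive.
Import Order.TTheory GRing.Theory Num.Theory.
Local Open Scope classical_set_scope.
Local Open Scope ring_scope.

(** Write [A] for the real matrix of the system, [M] for the largest row
    1-norm, and [r] for the quotient of the largest by the smallest absolute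
    value of a maximal minor.

    Two facts about [A] and [u] carry the proof. Since all maximal minors are
    nonzero and comparable up to the factor [r], Cramer's rule shows that in a
    linear dependency between at most [n + 1] rows of [A] any coefficient is at
    most [r] times any other one ([dependency_ratio]). Since taking integer
    parts changes each [(A x)_j] by at most [M], a point [x] satisfying the
    system shrunk to [A x <= u - M] rounds to a lattice point of the
    polyhedron, that is to [0], so that [(A x)_i <= M]
    ([lattice_free_rounding]).

    Suppose [u_i > 2 M]. Then the two systems
      [A_j x <= u_j - M] for all [j], and
      [A_j x <= u_j - M] for [j != i] together with [A_i x >= u_i / 2]
    are not both feasible: a solution of the first one has [A_i x <= M], so on
    the segment towards a solution of the second one some point has
    [A_i x = u_i / 2], which contradicts the rounding fact since
    [M < u_i / 2 <= u_i - M]. Hence one of them has a Farkas certificate, which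
    by Caratheodory's theorem may be supported on [n + 1] rows
    ([basic_farkas]).

    A certificate of the second system writes [A_i] as a combination of other
    rows with coefficients in [[0, r]]. The lattice point [z] gained by
    removing inequality [i] has [u_i < A_i z] and [A_j z <= u_j] for the other
    [j], so [u_i] is at most the same combination of the [u_j]
    ([conic_combination_bound]), which the certificate bounds by
    [u_i / 2 + M (n + 1) r].

    A certificate of the first system is a dependency [sum_j y_j A_j = 0] with
    [y >= 0] and [sum_j y_j u_j < M sum_j y_j]. If [y_i > 0], comparing
    coefficients gives [u_i <= M (n + 1) r] at once
    ([positive_dependency_through]). If [y_i = 0], then [A_i] still has to be
    expressed through the support of [y], and a careless estimate would cost
    [r] twice, once for this expression and once for the sizes of the [u_j];
    [positive_dependency_avoiding] explains how to pay only once, at the price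
    of a factor 2. *)

(** * Systems of linear inequalities *)

Lemma separating_value (F : realFieldType) (I : finType) (L U : pred I)
    (l v : I -> F) :
  (forall p q, L p -> U q -> l p <= v q) ->
  exists t, (forall p, L p -> l p <= t) /\ (forall q, U q -> t <= v q).
Proof.
move=> le_lv; case: (pickP L) => [p0 Lp0 | L0].
  case: (Order.TotalTheory.arg_maxP l Lp0) => p Lp maxp.
  by exists (l p); split=> [p' /maxp | q Uq] //; apply: le_lv.
case: (pickP U) => [q0 Uq0 | U0].
  case: (Order.TotalTheory.arg_minP v Uq0) => q Uq minq.
  by exists (v q); split=> [p' | q' /minq] //; rewrite L0.
by exists 0; split=> p; rewrite ?L0 ?U0.
Qed.

Lemma one_variable_system (F : realFieldType) (m : nat) (c d : 'cV[F]_m) :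
  (forall p q, 0 < c p 0 -> c q 0 < 0 -> c q 0 * d p 0 <= c p 0 * d q 0) ->
  (forall p, c p 0 = 0 -> 0 <= d p 0) ->
  exists t, forall p, c p 0 * t <= d p 0.
Proof.
move=> comb zero.
have [|t [lbt ubt]] := @separating_value F 'I_m
    (fun q => c q 0 < 0) (fun p => 0 < c p 0)
    (fun q => d q 0 / c q 0) (fun p => d p 0 / c p 0).
  move=> q p cq cp; rewrite ler_ndivrMr // mulrAC ler_pdivrMr //.
  by rewrite mulrC [leRHS]mulrC; apply: comb.
exists t => p; case: (ltrgtP (c p 0) 0) => [cp | cp | cp].
- by have := lbt p cp; rewrite ler_ndivrMr // mulrC.
- by have := ubt p cp; rewrite ler_pdivlMr // mulrC.
- by rewrite cp mul0r zero.
Qed.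

(** Multipliers of one Fourier-Motzkin step. A pair of rows with opposite signs
    in [c] yields the combination cancelling the eliminated variable; diagonal
    pairs carry over the rows in which that variable is absent; all remaining
    pairs yield the trivial inequality, so that the new system can be indexed by
    all pairs. *)
Definition elimination_weight (F : realFieldType) (m : nat) (c : 'cV[F]_m)
    (pq : 'I_m * 'I_m) : 'rV[F]_m :=
  let: (p, q) := pq in
  if (0 < c p 0) && (c q 0 < 0) then
    c p 0 *: delta_mx 0 q - c q 0 *: delta_mx 0 p
  else if (p == q) && (c p 0 == 0) then delta_mx 0 p else 0.

Lemma elimination_weight_ge0 (F : realFieldType) m (c : 'cV[F]_m) pq j :
  0 <= elimination_weight c pq 0 j.
Proof.
case: pq => p q /=; case: ifP => [/andP[cp cq] | _].
  by rewrite !mxE addr_ge0 // -?mulNr mulr_ge0 ?ler0n ?oppr_ge0 // ltW.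
by case: ifP => _; rewrite !mxE ?ler0n.
Qed.

Lemma elimination_weight_kernel (F : realFieldType) m (c : 'cV[F]_m) pq :
  elimination_weight c pq *m c = 0.
Proof.
apply/matrixP=> a b; rewrite !ord1; case: pq => p q /=.
case: ifP => _.
  by rewrite mulmxBl -!scalemxAl -!rowE !mxE mulrC subrr.
case: ifP => [/andP[_ /eqP cp] | _]; last by rewrite mul0mx.
by rewrite -rowE !mxE.
Qed.

Definition elimination_matrix (F : realFieldType) (m : nat) (c : 'cV[F]_m) :
    'M[F]_(#|{: 'I_m * 'I_m}|, m) :=
  \matrix_(k, j) elimination_weight c (enum_val k) 0 j.

Lemma row_elimination_matrix (F : realFieldType) m (c : 'cV[F]_m) pq :
  row (enum_rank pq) (elimination_matrix c) = elimination_weight c pq.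
Proof. by apply/rowP=> j; rewrite !mxE enum_rankK. Qed.

(** Fourier-Motzkin elimination of the first variable: the eliminated system
    is [W *m A <= W *m b] for a nonnegative matrix [W], so a solution extends by
    [one_variable_system] and a certificate [y] pulls back to [y *m W]. *)
Lemma farkas (F : realFieldType) (m n : nat) (A : 'M[F]_(m, n)) (b : 'cV[F]_m) :
  (exists x : 'cV_n, forall i, (A *m x) i 0 <= b i 0) \/
  (exists y : 'rV_m, [/\ forall j, 0 <= y 0 j, y *m A = 0 & (y *m b) 0 0 < 0]).
Proof.
elim: n m A b => [|n IHn] m A b.
  case: (pickP (fun i => b i 0 < 0)) => [i bi | b_ge0].
    right; exists (delta_mx 0 i); split=> [j||]; first by rewrite mxE ler0n.
      by apply/matrixP=> ? [].
    by rewrite -rowE mxE.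
  left; exists 0 => i; rewrite mulmx0 mxE leNgt.
  by rewrite b_ge0.
pose c : 'cV_m := lsubmx (A : 'M_(m, 1 + n)).
pose A' : 'M_(m, n) := rsubmx (A : 'M_(m, 1 + n)).
have defA : A = row_mx c A' :> 'M_(m, 1 + n) by rewrite hsubmxK.
pose W := elimination_matrix c.
have WE pq (e : 'cV_m) :
    (W *m e) (enum_rank pq) 0 = (elimination_weight c pq *m e) 0 0.
  by rewrite -row_elimination_matrix -row_mul [RHS]mxE.
have [[x' x'P] | [y' [y'0 y'A y'b]]] := IHn _ (W *m A') (W *m b).
  left; pose d := b - A' *m x'.
  have dP pq : 0 <= (elimination_weight c pq *m d) 0 0.
    by have := x'P (enum_rank pq); rewrite -mulmxA !WE mulmxBr !mxE subr_ge0.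
  have [||t tP] := @one_variable_system F m c d.
  - move=> p q cp cq; have := dP (p, q).
    by rewrite /= cp cq /= mulmxBl -!scalemxAl -!rowE !mxE subr_ge0.
  - move=> p cp; have := dP (p, p).
    by rewrite /= cp ltxx /= !eqxx /= -rowE !mxE.
  exists (col_mx t%:M x' : 'cV_(1 + n)) => i.
  have := tP i; rewrite [A]defA (@mul_row_col _ m 1 n 1).
  by rewrite /d !mxE big_ord1 !mxE mulr1n lerBrDr.
right; exists (y' *m W); split=> [j||].
- rewrite mxE sumr_ge0 // => k _.
  by rewrite mulr_ge0 // mxE elimination_weight_ge0.
- rewrite [A]defA (@mul_mx_row _ _ _ 1 n) -!mulmxA y'A.
  have -> : W *m c = 0.
    apply/row_matrixP=> k; rewrite -(enum_valK k) row_mul.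
    by rewrite row_elimination_matrix elimination_weight_kernel row0.
  by rewrite mulmx0 row_mx0.
- by rewrite -mulmxA.
Qed.

(** * Supports of linear combinations *)

Definition row_support (F : fieldType) (m : nat) (y : 'rV[F]_m) : {set 'I_m} :=
  [set j | y 0 j != 0]%SET.

Lemma dependent_rows (F : fieldType) (m n : nat) (C : 'M[F]_(m, n))
    (J : {set 'I_m}) :
  (n < #|J|)%N ->
  exists z : 'rV_m, [/\ z != 0, row_support z \subset J & z *m C = 0].
Proof.
move=> ltnJ; pose f : 'I_#|J| -> 'I_m := enum_val.
have rf : \rank (kermx (rowsub f C)) != 0%N.
  by rewrite mxrank_ker subn_eq0 -ltnNge (leq_ltn_trans (rank_leq_col _)).
have [v vC vn0] : exists2 v : 'rV_#|J|, v *m rowsub f C = 0 & v != 0.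
  have /rowV0Pn[v /sub_kermxP vC vn0] : kermx (rowsub f C) != 0.
    by rewrite -mxrank_eq0.
  by exists v.
have fC : rowsub f C = rowsub f 1%:M *m C by rewrite mul_rowsub_mx mul1mx.
have zE l : (v *m rowsub f 1%:M) 0 (f l) = v 0 l.
  rewrite mxE (bigD1 l) //= !mxE eqxx mulr1 big1 ?addr0 // => l' ne.
  by rewrite !mxE (inj_eq enum_val_inj) (negPf ne) mulr0.
exists (v *m rowsub f 1%:M); split.
- apply: contraNneq vn0 => z0; apply/eqP/rowP=> l.
  by rewrite -zE z0 !mxE.
- apply/fintype.subsetP=> j; rewrite inE; apply: contraR => jJ.
  rewrite mxE big1 // => l _; rewrite !mxE; case: eqP => [fl|]; last by rewrite mulr0.
  by case/negP: jJ; rewrite -fl enum_valP.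
- by rewrite -mulmxA -fC.
Qed.

(** As long as the support has more elements than [C] has columns, it carries
    a linear dependency [z]; moving from [y] along [- z] until some
    coordinate vanishes keeps [y] nonnegative and shrinks the support. *)
Lemma conic_caratheodory (F : realFieldType) (m n : nat) (C : 'M[F]_(m, n))
    (y : 'rV_m) :
  (forall j, 0 <= y 0 j) ->
  exists y' : 'rV_m, [/\ forall j, 0 <= y' 0 j, y' *m C = y *m C
    & (#|row_support y'| <= n)%N].
Proof.
have [k] := ubnP #|row_support y|; elim: k y => // k IHk y ltyk y0.
case: (leqP #|row_support y| n) => [le_n | ltn]; first by exists y.
have [z [zn0 zy zC]] : exists z : 'rV_m,
    [/\ exists j, 0 < z 0 j, row_support z \subset row_support y & z *m C = 0].
  have [z [/eqP zn0 zy zC]] := dependent_rows C ltn.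
  have [j zj] : exists j, z 0 j != 0.
    apply/existsP; rewrite -negb_forall; apply: contra_notN zn0 => /forallP z0.
    by apply/rowP=> j; rewrite !mxE; apply/eqP.
  (* The dependency is only defined up to sign; the ratio test below needs a
     positive coordinate. *)
  case: (ltrgtP (z 0 j) 0) zj => // [zj | zj] _; last by exists z; split=> //; exists j.
  exists (- z); split; first by exists j; rewrite mxE oppr_gt0.
    by apply: fintype.subset_trans zy; apply/fintype.subsetP=> l; rewrite !inE mxE oppr_eq0.
  by rewrite mulNmx zC oppr0.
have suppz l : y 0 l = 0 -> z 0 l = 0.
  move=> yl; apply/eqP/negPn/negP => zl.
  by have := fintype.subsetP zy l; rewrite !inE zl yl eqxx => /(_ isT).
have [j0 zj0] := zn0.
case: (Order.TotalTheory.arg_minP (fun j => y 0 j / z 0 j) (zj0 : [pred j | 0 < z 0 j] j0)) => j /= zj minj.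
pose t := y 0 j / z 0 j.
have t0 : 0 <= t by rewrite divr_ge0 // ltW.
have [||y' [y'0 y'C cy']] := IHk (y - t *: z).
- rewrite -ltnS; apply: leq_trans ltyk; rewrite ltnS; apply: proper_card.
  apply/properP; split; last first.
    exists j; rewrite !inE ?mxE; last by rewrite /t (divfK (lt0r_neq0 zj)) subrr eqxx.
    by apply: contraTN zj => /eqP /suppz ->; rewrite ltxx.
  apply/fintype.subsetP=> l; rewrite !inE !mxE; apply: contraNN => /eqP yl.
  by rewrite yl suppz // mulr0 subr0.
- move=> l; rewrite !mxE subr_ge0.
  case: (ltP 0 (z 0 l)) => [zl | zl]; first by rewrite -ler_pdivlMr // minj.
  by rewrite (le_trans _ (y0 l)) // mulr_ge0_le0.
by exists y'; split=> //; rewrite y'C mulmxBl -scalemxAl zC scaler0 subr0.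
Qed.

(** The certificate conditions only involve [y *m A] and [y *m b], that is
    [n + 1] linear forms, so Caratheodory's theorem for [row_mx A b] bounds the
    support. *)
Lemma basic_farkas (F : realFieldType) (m n : nat) (A : 'M[F]_(m, n)) (b : 'cV[F]_m) :
  (exists x : 'cV_n, forall i, (A *m x) i 0 <= b i 0) \/
  (exists y : 'rV_m, [/\ forall j, 0 <= y 0 j, y *m A = 0, (y *m b) 0 0 < 0
    & (#|row_support y| <= n.+1)%N]).
Proof.
have [|[y [y0 yA yb]]] := farkas A b; [by left | right].
have [y' [y'0 /eqP y'C cy']] := conic_caratheodory (row_mx A b) y0.
move: y'C; rewrite !mul_mx_row => /eqP/eq_row_mx[y'A y'b].
by exists y'; split; rewrite ?y'A ?y'b // -addn1.
Qed.

Lemma sum_row_le (F : realFieldType) (m : nat) (y : 'rV[F]_m) (J : {set 'I_m}) c k :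
  row_support y \subset J -> (#|J| <= k)%N -> 0 <= c -> (forall j, y 0 j <= c) ->
  \sum_j y 0 j <= k%:R * c.
Proof.
move=> yJ Jk c0 yc; rewrite (bigID (mem J)) /= [X in _ + X]big1 => [|j jJ].
  rewrite addr0 (le_trans (ler_sum _ (fun j _ => yc j))) // sumr_const.
  by rewrite -[leLHS]mulr_natl ler_wpM2r // ler_nat.
by apply/eqP; apply: contraNT jJ => yj; apply: (fintype.subsetP yJ); rewrite inE.
Qed.

(** * Maximal minors *)

(** Bridges the minors indexed by increasing row selections and those indexed
    by injective ones, which arise when one row of a selection is replaced. *)
Lemma sorting_permutation (m n : nat) (f : 'I_n -> 'I_m) :
  injective f -> exists s : 'S_n, increasing [ffun l => f (s l)].
Proof.
move=> injf; pose t := [tuple f l | l < n].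
pose t' := sort_tuple (fun a b : 'I_m => (a <= b)%N) t.
have [s tE] : exists s : 'S_n, t' = [tuple tnth t (s i) | i < n] :> seq 'I_m.
  by apply/tuple_permP; rewrite /= perm_sort.
exists s; apply/forallP=> a; apply/forallP=> b; apply/implyP=> ltab.
have E (l : 'I_n) : nth (f a) t' l = f (s l).
  by rewrite tE -tnth_nth !tnth_mktuple.
rewrite !ffunE -!E ltn_neqAle; apply/andP; split.
  by rewrite !E (inj_eq val_inj) (inj_eq injf) (inj_eq perm_inj) neq_ltn ltab.
apply: (@sorted_leq_nth _ (fun a b : 'I_m => (a <= b)%N)) => //.
- by move=> ? ? ?; apply: leq_trans.
- by apply: sort_sorted => ? ?; apply: leq_total.
- by rewrite inE size_tuple.
- by rewrite inE size_tuple.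
- exact: ltnW.
Qed.

Lemma bigmin_le (I : eqType) (s : seq I) (P : pred I) (F : I -> nat) x i :
  i \in s -> P i -> (\big[minn/x]_(j <- s | P j) F j <= F i)%N.
Proof.
elim: s => // k s IHs; rewrite inE big_cons => /predU1P[<- Pi | si Pi].
  by rewrite Pi geq_minl.
by case: ifP => _; rewrite ?geq_min IHs ?orbT.
Qed.

Lemma bigmin_le_start (I : Type) (s : seq I) (P : pred I) (F : I -> nat) x :
  (\big[minn/x]_(j <- s | P j) F j <= x)%N.
Proof.
elim: s => [|k s IHs]; first by rewrite big_nil.
by rewrite big_cons; case: ifP => _; rewrite ?geq_min IHs ?orbT.
Qed.

Lemma injective_subdet_bounds (m n : nat) (S : 'M[int]_(m, n)) (f : 'I_n -> 'I_m) :
  injective f ->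
  (min_subdet S <= `|\det (rowsub f S)| <= max_subdet S)%N.
Proof.
move=> /sorting_permutation[s incr].
have <- : abs_subdet S [ffun l => f (s l)] = `|\det (rowsub f S)|%N.
  have -> : abs_subdet S [ffun l => f (s l)] = `|\det (row_perm s (rowsub f S))|%N.
    congr `|\det _|%N; apply/matrixP=> a b; by rewrite !mxE ffunE.
  by rewrite row_permE det_mulmx det_perm abszMsign.
by rewrite /min_subdet bigmin_le ?mem_index_enum //= leq_bigmax_cond.
Qed.

Lemma min_subdet_le_max (m n : nat) (S : 'M[int]_(m, n)) :
  (min_subdet S <= max_subdet S)%N.
Proof. exact: bigmin_le_start. Qed.

Lemma min_subdet_neq0_leq (m n : nat) (S : 'M[int]_(m, n)) :
  min_subdet S <> 0%N -> (n <= m)%N.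
Proof.
apply: contra_notT; rewrite -ltnNge => ltmn.
apply/eqP; rewrite -leqn0; apply: (leq_trans (min_subdet_le_max S)).
apply/bigmax_leqP => f incr.
have lt_f (a b : 'I_n) : (a < b)%N -> (f a < f b)%N.
  by move/forallP/(_ a)/forallP/(_ b)/implyP: incr; apply.
have : injective f.
  move=> a b fab; apply: val_inj => /=.
  by case: (ltngtP a b) => // /lt_f; rewrite fab ltnn.
by move=> /leq_card; rewrite !card_ord leqNgt ltmn.
Qed.

Lemma rowsub_subdet_bounds (R : realDomainType) (m n : nat) (S : 'M[int]_(m, n))
    (f : 'I_n -> 'I_m) :
  injective f ->
  (min_subdet S)%:R <= `|\det (rowsub f (map_mx intr S : 'M[R]_(m, n)))|
    <= (max_subdet S)%:R.
Proof.
move=> /(injective_subdet_bounds S).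
by rewrite -map_mxsub det_map_mx -intr_norm -abszE -pmulrn !ler_nat.
Qed.

(** A small set of rows need not have [n] elements; padding it to [n] rows is
    what allows a maximal minor to see it. *)
Lemma injection_through (m n : nat) (A : {set 'I_m}) :
  (#|A| <= n)%N -> (n <= m)%N ->
  exists2 f : 'I_n -> 'I_m, injective f & A \subset codom f.
Proof.
move=> leAn lenm; pose s := enum A ++ enum (~: A)%SET.
have sizes : size s == m.
  by rewrite size_cat -!cardE cardsC card_ord.
have us : uniq s.
  rewrite cat_uniq !enum_uniq andbT /=; apply/hasPn=> x.
  by rewrite !mem_enum inE.
exists (fun l => tnth (Tuple sizes) (widen_ord lenm l)).
  move=> k l /(tuple_uniqP (Tuple sizes) us) /(congr1 val) /= kl.
  exact: val_inj.
apply/fintype.subsetP=> j jA.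
have ltj : (index j (enum A) < n)%N.
  by apply: leq_trans leAn; rewrite cardE index_mem mem_enum.
apply/codomP; exists (Ordinal ltj).
rewrite (tnth_nth j) /= nth_cat index_mem mem_enum jA nth_index //.
by rewrite mem_enum.
Qed.

(** Laplace expansion along row [l]: the cofactors of that row do not depend on
    it, so replacing it gives a linear function of the new row. *)
Lemma cofactor_functional (F : comNzRingType) (m n : nat) (A : 'M[F]_(m, n))
    (f : 'I_n -> 'I_m) (l : 'I_n) :
  exists w : 'cV_n, forall k,
    (A *m w) k 0 = \det (rowsub (fun a => if a == l then k else f a) A).
Proof.
exists (\col_a cofactor (rowsub f A) l a) => k.
rewrite (expand_det_row _ l) mxE; apply: eq_bigr => a _.
rewrite !mxE eqxx; congr (_ * (_ * \det _)).
by apply/matrixP=> b c; rewrite !mxE eq_sym (negPf (neq_lift _ _)).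
Qed.

Lemma det_rowsub_noninjective (F : comNzRingType) (m n : nat)
    (A : 'M[F]_(m, n)) (f : 'I_n -> 'I_m) :
  ~ injective f -> \det (rowsub f A) = 0.
Proof.
move=> ninj; have /injectivePn[a [b ab fab]] : ~~ injectiveb f.
  by apply/negP=> /injectiveP.
by apply: (determinant_alternate ab) => c; rewrite !mxE fab.
Qed.

(** Choose [n] rows that contain [J] minus [k], and apply to the dependency the
    linear form [v |-> det], where [v] replaces row [j] among them. Every row of
    [J] other than [j] and [k] is repeated and contributes [0], which leaves
    [z_j det_j + z_k det_k = 0] with [|det_j| >= lo] and [|det_k| <= hi]. Taking
    [z_k = 0] shows that any [n] rows are independent. *)
Lemma dependency_ratio (R : realFieldType) (m n : nat) (A : 'M[R]_(m, n)) (lo hi : R)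
    (z : 'rV_m) (J : {set 'I_m}) :
  (n <= m)%N -> 0 < lo -> lo <= hi ->
  (forall f : 'I_n -> 'I_m, injective f -> lo <= `|\det (rowsub f A)| <= hi) ->
  z *m A = 0 -> row_support z \subset J -> (#|J| <= n.+1)%N ->
  forall j k, k \in J -> `|z 0 j| <= hi / lo * `|z 0 k|.
Proof.
move=> lenm lo0 lohi bnd zA zJ cardJ j k kJ.
have r1 : 1 <= hi / lo by rewrite ler_pdivlMr ?mul1r.
have [<- | jk] := eqVneq j k; first exact: ler_peMl.
have [zj | zj] := eqVneq (z 0 j) 0.
  by rewrite zj normr0 mulr_ge0 // (le_trans _ r1).
have [f injf fJ] : exists2 f : 'I_n -> 'I_m, injective f & (J :\ k)%SET \subset codom f.
  by apply: injection_through => //; rewrite -ltnS (leq_trans _ cardJ) // (cardsD1 k J) kJ.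
have jJ : j \in (J :\ k)%SET.
  by rewrite !inE jk (fintype.subsetP zJ) // inE.
have /codomP[l jl] := fintype.subsetP fJ _ jJ.
have [w wP] := cofactor_functional A f l.
pose g i a := if a == l then i else f a.
have gj : rowsub (g j) A = rowsub f A.
  by apply/matrixP=> a b; rewrite !mxE /g; case: eqP => // ->; rewrite jl.
have sum0 : z 0 j * \det (rowsub f A) + z 0 k * \det (rowsub (g k) A) = 0.
  have : (z *m (A *m w)) 0 0 = 0 by rewrite mulmxA zA mul0mx mxE.
  rewrite mxE (bigD1 j) //= (bigD1 k) 1?eq_sym //= big1 => [|i /andP[ij ik]].
    by rewrite addr0 !wP gj.
  have [zi | zi] := eqVneq (z 0 i) 0; first by rewrite zi mul0r.
  have /codomP[l' il'] : i \in codom f.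
    by apply: (fintype.subsetP fJ); rewrite !inE ik (fintype.subsetP zJ) // inE.
  rewrite wP det_rowsub_noninjective ?mulr0 // => /(_ l l').
  rewrite eqxx; case: eqP => [l'l _ | l'l /(_ il') ll']; last by case: l'l.
  by move: ij; rewrite il' l'l -jl eqxx.
have gk : `|\det (rowsub (g k) A)| <= hi.
  have [/bnd/andP[] // | ninj] := pselect (injective (g k)).
  by rewrite det_rowsub_noninjective // normr0 (le_trans _ lohi) // ltW.
have /andP[fl _] := bnd f injf.
rewrite mulrAC ler_pdivlMr //.
apply: (le_trans (ler_wpM2l _ fl)) => //.
move/eqP: sum0; rewrite addr_eq0 => /eqP; rewrite -normrM => ->.
by rewrite normrN normrM mulrC ler_wpM2r.
Qed.

(** * Bounding a right-hand side *)

(** Here [z] is the point that enters when inequality [i] is removed. Evaluating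
    the combination at [z] bounds even [(A *m z) i 0], which exceeds [U i 0]. *)
Lemma conic_combination_bound (F : realFieldType) (m n : nat) (A : 'M[F]_(m, n))
    (U : 'cV[F]_m) (i : 'I_m) (z : 'cV[F]_n) (w : 'rV[F]_m) :
  (forall j, j != i -> (A *m z) j 0 <= U j 0) -> U i 0 < (A *m z) i 0 ->
  (forall j, 0 <= w 0 j) -> w 0 i = 0 -> w *m A = row i A ->
  U i 0 <= (w *m U) 0 0.
Proof.
move=> zj zi w0 wi wA; apply: (le_trans (ltW zi)).
have -> : (A *m z) i 0 = (w *m (A *m z)) 0 0 by rewrite mulmxA wA -row_mul [RHS]mxE.
rewrite mxE [leRHS]mxE; apply: ler_sum => j _.
by have [-> | ji] := eqVneq j i; [rewrite wi !mul0r | rewrite ler_wpM2l ?zj].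
Qed.

(** The support is only required to lie in [J], and [k] need not be in it: with
    [z 0 k = 0] the inequality says that the rows of [J] other than [k] are
    independent. *)
Definition bounded_dependencies (F : realFieldType) (m n : nat)
    (A : 'M[F]_(m, n)) (r : F) :=
  forall (z : 'rV_m) (J : {set 'I_m}), z *m A = 0 -> row_support z \subset J ->
    (#|J| <= n.+1)%N -> forall j k, k \in J -> `|z 0 j| <= r * `|z 0 k|.

(** All [y_j] are at most [r y_i], so
    [y_i U_i <= sum_j y_j U_j <= M sum_j y_j <= M (n + 1) r y_i]. *)
Lemma positive_dependency_through (F : realFieldType) (m n : nat)
    (A : 'M[F]_(m, n)) (U : 'cV[F]_m) (r M : F) (i : 'I_m) (y : 'rV[F]_m) :
  bounded_dependencies A r -> 0 <= r -> 0 <= M -> (forall j, 0 <= U j 0) ->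
  (forall j, 0 <= y 0 j) -> y *m A = 0 -> (#|row_support y| <= n.+1)%N ->
  (y *m U) 0 0 <= M * \sum_j y 0 j -> y 0 i != 0 ->
  U i 0 <= M * (n.+1%:R * r).
Proof.
move=> bndA r0 M0 U0 y0 yA cy yU yi.
have yi0 : 0 < y 0 i by rewrite lt0r yi y0.
have sum_le : \sum_j y 0 j <= n.+1%:R * (r * y 0 i).
  apply: (sum_row_le (subxx _) cy) => [|j]; first by rewrite mulr_ge0.
  rewrite -(ger0_norm (y0 j)) -(ger0_norm (y0 i)).
  by apply: (bndA y _ yA (subxx _)) => //; rewrite inE.
rewrite -(ler_pM2l yi0); apply: (@le_trans _ _ ((y *m U) 0 0)).
  by rewrite mxE (bigD1 i) //= lerDl sumr_ge0 // => j _; rewrite mulr_ge0.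
apply: (le_trans yU); apply: (le_trans (ler_wpM2l M0 sum_le)).
by rewrite le_eqVlt; apply/orP; left; apply/eqP; ring.
Qed.

(** By independence of any [n] rows the support [J] of [y] has exactly [n + 1]
    elements. Exchanging one of them for [i] gives [n + 1] vectors in dimension
    [n], whose dependency has a nonzero coefficient at [i] and can be solved for
    row [i]. *)
Lemma expansion_along_dependency (F : realFieldType) (m n : nat)
    (A : 'M[F]_(m, n)) (r : F) (i : 'I_m) (y : 'rV[F]_m) :
  bounded_dependencies A r -> y *m A = 0 -> y != 0 -> y 0 i = 0 ->
  (#|row_support y| <= n.+1)%N ->
  exists v : 'rV_m, [/\ v *m A = row i A, v 0 i = 0
    & row_support v \subset row_support y].
Proof.
move=> bndA yA yn0 yi cy; set J := row_support y in cy *.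
have iJ : i \notin J by rewrite inE yi eqxx.
have vanish (z : 'rV_m) (K : {set 'I_m}) : z *m A = 0 -> row_support z \subset K ->
    (#|K| <= n.+1)%N -> i \in K -> z 0 i = 0 -> z = 0.
  move=> zA zK cK iK zi; apply/rowP=> j; apply/eqP; rewrite mxE -normr_le0.
  by have := bndA z K zA zK cK j i iK; rewrite zi normr0 mulr0.
have cJ : #|J| = n.+1.
  apply/eqP; rewrite eqn_leq cy ltnNge; apply: contra_neqN yn0 => ltJ.
  apply: (vanish y (i |: J)%SET yA) => //; last by rewrite !inE eqxx.
    exact: finset.subsetUr.
  by rewrite cardsU1 iJ.
have [q qJ] : exists q, q \in J by apply/set0Pn; rewrite -card_gt0 cJ.
pose K := (i |: (J :\ q))%SET.
have cK : #|K| = n.+1.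
  by rewrite cardsU1 in_setD1 (negPf iJ) andbF; move: cJ; rewrite (cardsD1 q J) qJ.
have [|z [zn0 zK zA]] := @dependent_rows _ _ _ A K; first by rewrite cK.
have zi : z 0 i != 0.
  apply: contra_neq zn0 => zi; apply: (vanish z K) => //; first by rewrite cK.
  by rewrite !inE eqxx.
exists (delta_mx 0 i - (z 0 i)^-1 *: z); split.
- by rewrite mulmxBl -scalemxAl zA scaler0 subr0 -rowE.
- by rewrite !mxE !eqxx mulVf // subrr.
- apply/fintype.subsetP=> j; rewrite inE !mxE /=.
  have [-> | ji] := eqVneq j i; first by rewrite mulVf // subrr eqxx.
  rewrite sub0r oppr_eq0 mulf_eq0 invr_eq0 (negPf zi) /= => zj.
  have := fintype.subsetP zK j; rewrite inE zj => /(_ isT).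
  by rewrite in_setU1 (negPf ji) /= => /setD1P[].
Qed.

(** Expand row [i] as [sum_j v_j A_j] over the support [J] of [y] and set
    [rho_j = v_j / y_j]. Adding multiples of [y] gives, for every [q] in [J], an
    expansion with coefficients [v_j - rho_q y_j = (rho_j - rho_q) y_j], which
    avoids [q]; together with [i] it uses only [n + 1] rows, so all these
    coefficients are at most [r] in absolute value. For [p] minimizing [rho] the
    expansion is nonnegative, whence, with [q] maximizing [rho],
    [U_i <= sum_j (rho_j - rho_p) y_j U_j <= (rho_q - rho_p) sum_j y_j U_j
         <= M sum_j (rho_q - rho_p) y_j].
    The bounds for [p] and [q] now add up to [(rho_q - rho_p) y_j <= 2 r]. Using
    them on this sum, and not on the [U_j] separately, is what makes [r] enter
    only once. *)
Lemma positive_dependency_avoiding (F : realFieldType) (m n : nat)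
    (A : 'M[F]_(m, n)) (U : 'cV[F]_m) (r M : F) (i : 'I_m) (z : 'cV[F]_n)
    (y : 'rV[F]_m) :
  bounded_dependencies A r -> 0 <= r -> 0 <= M -> (forall j, 0 <= U j 0) ->
  (forall j, j != i -> (A *m z) j 0 <= U j 0) -> U i 0 < (A *m z) i 0 ->
  (forall j, 0 <= y 0 j) -> y *m A = 0 -> y != 0 -> (#|row_support y| <= n.+1)%N ->
  (y *m U) 0 0 <= M * \sum_j y 0 j -> y 0 i = 0 ->
  U i 0 <= M * (n.+1%:R * (2 * r)).
Proof.
move=> bndA r0 M0 U0 zj zi y0 yA yn0 cy yU yi.
have [v [vA vi vJ]] := expansion_along_dependency bndA yA yn0 yi cy.
set J := row_support y in cy vJ.
have iJ : i \notin J by rewrite inE yi eqxx.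
have yJ j : j \notin J -> y 0 j = 0 by rewrite inE negbK => /eqP.
have vJ0 j : j \notin J -> v 0 j = 0.
  by move=> jJ; apply/eqP; apply: contraNT jJ => vj; apply: (fintype.subsetP vJ); rewrite inE.
have yp j : j \in J -> 0 < y 0 j by rewrite inE lt0r y0 andbT.
pose rho j := v 0 j / y 0 j.
have vE j : j \in J -> v 0 j = rho j * y 0 j by move=> /yp yj; rewrite divfK ?gt_eqF.
have close q j : q \in J -> `|v 0 j - rho q * y 0 j| <= r.
  move=> qJ; have [-> | ji] := eqVneq j i; first by rewrite vi yi mulr0 subr0 normr0.
  (* This dependency between row [i] and the support of [y] has coefficient 1
     at [i] and, by the choice of [rho q], coefficient 0 at [q]. *)
  pose zq := delta_mx 0 i - (v - rho q *: y).
  have := bndA zq (i |: (J :\ q))%SET _ _ _ j i; rewrite !mxE !eqxx (negPf ji) /=.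
  rewrite vi yi mulr0 !subr0 normr1 mulr1 sub0r normrN; apply.
  - by rewrite !mulmxBl -scalemxAl yA scaler0 subr0 vA -rowE subrr.
  - apply/fintype.subsetP=> l; rewrite inE; apply: contraR.
    rewrite in_setU1 in_setD1 negb_or negb_and negbK => /andP[li lJ].
    rewrite !mxE (negPf li) /= sub0r oppr_eq0 subr_eq0.
    by case/orP: lJ => [/eqP -> | lJ]; [rewrite vE | rewrite vJ0 ?yJ ?mulr0].
  - by rewrite cardsU1 in_setD1 (negPf iJ) andbF; move: cy; rewrite (cardsD1 q J) qJ.
  - by rewrite !inE eqxx.
have [j0 j0J] : exists j, j \in J.
  apply/set0Pn; apply: contra_neq yn0 => J0; apply/rowP=> j.
  by rewrite mxE yJ // J0 inE.
case: (Order.TotalTheory.arg_minP rho j0J) => p pJ minp.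
case: (Order.TotalTheory.arg_maxP rho j0J) => q qJ maxq.
have pq : 0 <= rho q - rho p by rewrite subr_ge0 minp.
pose w := v - rho p *: y.
have wJ j : j \notin J -> w 0 j = 0 by move=> jJ; rewrite !mxE vJ0 ?yJ ?mulr0 ?subr0.
have wE j : j \in J -> w 0 j = (rho j - rho p) * y 0 j by move=> jJ; rewrite !mxE vE // mulrBl.
have Uw : U i 0 <= (w *m U) 0 0.
  apply: (conic_combination_bound zj zi).
  - move=> j; have [jJ | /wJ -> //] := boolP (j \in J).
    by rewrite wE // mulr_ge0 // subr_ge0 minp.
  - exact: wJ.
  - by rewrite mulmxBl -scalemxAl yA scaler0 subr0.
apply: (le_trans Uw); apply: (@le_trans _ _ ((rho q - rho p) * (y *m U) 0 0)).
  rewrite !mxE mulr_sumr; apply: ler_sum => j _; rewrite mulrA ler_wpM2r //.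
  have [jJ | jJ] := boolP (j \in J); last by rewrite wJ // yJ // mulr0.
  by rewrite wE // ler_wpM2r // lerD2r; apply: maxq.
apply: (le_trans (ler_wpM2l pq yU)).
rewrite mulrCA ler_wpM2l // mulr_sumr.
have -> : \sum_j (rho q - rho p) * y 0 j = \sum_j ((rho q - rho p) *: y) 0 j.
  by apply: eq_bigr => j _; rewrite mxE.
apply: (@sum_row_le _ _ _ J) => //; last 1 first.
- move=> j; rewrite mxE.
  have -> : (rho q - rho p) * y 0 j
      = (v 0 j - rho p * y 0 j) - (v 0 j - rho q * y 0 j) by ring.
  rewrite (le_trans (ler_norm _)) // (le_trans (ler_normB _ _)) //.
  by rewrite mulrDl mul1r lerD // close.
- apply/fintype.subsetP=> j; rewrite inE; apply: contraR => /yJ yj.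
  by rewrite mxE yj mulr0.
- by rewrite mulr_ge0.
Qed.

(** The core estimate, with the lattice present only through the point [z] and
    the rounding hypothesis. *)
Lemma right_hand_side_bound (F : realFieldType) (m n : nat)
    (A : 'M[F]_(m, n)) (U : 'cV[F]_m) (r M : F) (i : 'I_m) (z : 'cV[F]_n) :
  bounded_dependencies A r -> 1 <= r -> 0 <= M -> (forall j, 0 <= U j 0) ->
  (forall j, j != i -> (A *m z) j 0 <= U j 0) -> U i 0 < (A *m z) i 0 ->
  (forall x : 'cV_n, (forall j, (A *m x) j 0 <= U j 0 - M) -> (A *m x) i 0 <= M) ->
  U i 0 <= 2 * M * n.+1%:R * r.
Proof.
move=> bndA r1 M0 U0 zj zi rounding.
have r0 : 0 <= r := le_trans ler01 r1.
have positive (y : 'rV_m) : (forall j, 0 <= y 0 j) -> y *m A = 0 ->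
    (#|row_support y| <= n.+1)%N -> (y *m (U - const_mx M)) 0 0 < 0 ->
    U i 0 <= 2 * M * n.+1%:R * r.
  move=> y0 yA cy yb.
  have yU : (y *m U) 0 0 <= M * \sum_j y 0 j.
    move: yb; rewrite mulmxBr !mxE subr_lt0 => /ltW /le_trans; apply.
    by rewrite mulr_sumr; apply: ler_sum => j _; rewrite mxE mulrC.
  have yn0 : y != 0.
    by apply: contraTneq yb => ->; rewrite mul0mx mxE ltxx.
  have [yi | yi] := eqVneq (y 0 i) 0.
    apply: (le_trans (positive_dependency_avoiding bndA r0 M0 U0 zj zi y0 yA yn0 cy yU yi)).
    by rewrite le_eqVlt; apply/orP; left; apply/eqP; ring.
  apply: (le_trans (positive_dependency_through bndA r0 M0 U0 y0 yA cy yU yi)).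
  rewrite -!mulrA ler_peMl ?ler1n // !mulr_ge0 //.
have [[x1 x1P] | [y [y0 yA yb cy]]] := basic_farkas A (U - const_mx M); last exact: positive yb.
(* The second system: [d] reverses the sign of row [i], turning its upper
   bound into the lower bound [U i 0 / 2]. *)
pose d : 'rV[F]_m := \row_j if j == i then -1 else 1.
pose b : 'cV[F]_m := \col_j if j == i then - (U i 0 / 2) else U j 0 - M.
have [[x2 x2P] | [y [y0 yA yb cy]]] := basic_farkas (diag_mx d *m A) b.
  have [small | large] := leP (U i 0) (2 * M).
    have nr1 : 1 <= n.+1%:R * r by rewrite mulr_ege1 // ler1n.
    by rewrite (le_trans small) // -mulrA ler_peMr ?mulr_ge0.
  have x1j j : (A *m x1) j 0 <= U j 0 - M by have := x1P j; rewrite !mxE.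
  have x2j j : j != i -> (A *m x2) j 0 <= U j 0 - M.
    by move=> ji; have := x2P j; rewrite -mulmxA mul_diag_mx !mxE (negPf ji) mul1r.
  have x2i : U i 0 / 2 <= (A *m x2) i 0.
    by have := x2P i; rewrite -mulmxA mul_diag_mx !mxE eqxx mulN1r lerN2.
  have x1i := rounding x1 x1j.
  set a1 := (A *m x1) i 0 in x1i; set a2 := (A *m x2) i 0 in x2i.
  have lt12 : 0 < a2 - a1 by lra.
  (* The point of the segment where row [i] takes the value [U i 0 / 2]. *)
  pose t := (U i 0 / 2 - a1) / (a2 - a1).
  have t0 : 0 <= t by rewrite divr_ge0 //; lra.
  have t1 : t <= 1 by rewrite ler_pdivrMr // mul1r; lra.
  have xE j : (A *m (x1 + t *: (x2 - x1))) j 0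
      = (1 - t) * (A *m x1) j 0 + t * (A *m x2) j 0.
    by rewrite mulmxDr -scalemxAr mulmxBr !mxE; ring.
  have xi : (A *m (x1 + t *: (x2 - x1))) i 0 = U i 0 / 2.
    have ta : t * (a2 - a1) = U i 0 / 2 - a1 by rewrite divfK ?gt_eqF.
    by rewrite xE -/a1 -/a2; lra.
  have : (A *m (x1 + t *: (x2 - x1))) i 0 <= M.
    apply: rounding => j; have [-> | ji] := eqVneq j i; first by rewrite xi; lra.
    rewrite xE (_ : U j 0 - M = (1 - t) * (U j 0 - M) + t * (U j 0 - M)); last by ring.
    by rewrite lerD // ler_wpM2l ?subr_ge0 ?x2j.
  by rewrite xi; lra.
(* A certificate of the second system which does not use row [i] is also one
   of the first system. *)
have [yi | yi] := eqVneq (y 0 i) 0.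
  have yd : y *m diag_mx d = y.
    by apply/rowP=> j; rewrite mul_mx_diag !mxE; case: eqP => [-> | _]; rewrite ?yi ?mul0r ?mulr1.
  apply: (positive y) => //; first by rewrite -{1}yd -mulmxA.
  apply: le_lt_trans yb; rewrite le_eqVlt; apply/orP; left; apply/eqP.
  rewrite !mxE; apply: eq_bigr => j _; rewrite !mxE.
  by case: eqP => // ->; rewrite yi !mul0r.
have yi0 : 0 < y 0 i by rewrite lt0r yi y0.
pose y' := y *m diag_mx d.
have y'i : y' 0 i = - y 0 i by rewrite /y' mul_mx_diag !mxE eqxx mulrN1.
have y'j j : j != i -> y' 0 j = y 0 j by move=> ji; rewrite /y' mul_mx_diag !mxE (negPf ji) mulr1.
have y'A : y' *m A = 0 by rewrite -mulmxA.
(* Solving the dependency for row [i]; [w] is the resulting nonnegative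
   expansion. *)
pose w : 'rV[F]_m := delta_mx 0 i + (y 0 i)^-1 *: y'.
have wi : w 0 i = 0.
  by rewrite 2!mxE !eqxx mxE y'i mulrN mulVf // subrr.
have wj j : j != i -> w 0 j = y 0 j / y 0 i.
  by move=> ji; rewrite 2!mxE (negPf ji) andbF add0r mxE y'j // mulrC.
have w0 j : 0 <= w 0 j.
  by have [-> | ji] := eqVneq j i; [rewrite wi | rewrite wj // divr_ge0].
have Uw : U i 0 <= (w *m U) 0 0.
  apply: (conic_combination_bound zj zi) => //.
  by rewrite mulmxDl -scalemxAl y'A scaler0 addr0 -rowE.
have wU : (w *m U) 0 0 <= U i 0 / 2 + M * \sum_j w 0 j.
  rewrite -(ler_pM2l yi0) -subr_le0; apply: le_trans (ltW yb).
  rewrite le_eqVlt; apply/orP; left; apply/eqP.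
  rewrite mxE [RHS]mxE (bigD1 i) //= wi mul0r add0r.
  rewrite [in X in _ - X](bigD1 i) //= wi add0r [RHS](bigD1 i) //= [b i 0]mxE eqxx.
  rewrite mulrDr opprD addrCA mulrN; congr (_ + _).
  rewrite !mulr_sumr -sumrB; apply: eq_bigr => j ji.
  by rewrite wj // [b j 0]mxE (negPf ji); field.
have sum_w : \sum_j w 0 j <= n.+1%:R * r.
  apply: (sum_row_le _ cy) => // [|j].
    apply/fintype.subsetP=> j; rewrite !inE; apply: contraNN => /eqP yj.
    have [-> | ji] := eqVneq j i; first by rewrite wi.
    by rewrite wj // yj mul0r.
  have [-> | ji] := eqVneq j i; first by rewrite wi.
  rewrite wj // ler_pdivrMr //.
  have := bndA y' (row_support y) y'A _ cy j i; rewrite y'i y'j // normrN !ger0_norm //.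
  apply; last by rewrite inE.
  apply/fintype.subsetP=> l; rewrite !inE; apply: contraNN => /eqP yl.
  by rewrite /y' mul_mx_diag mxE yl mul0r.
have := ler_wpM2l M0 sum_w.
rewrite (_ : 2 * M * n.+1%:R * r = 2 * (M * (n.+1%:R * r))); last by ring.
by lra.
Qed.

(** * Lattice-free polyhedra *)

Lemma row_norm1_bound (R : numDomainType) (m n : nat) (S : 'M[int]_(m, n)) (x : 'cV[R]_n) i :
  (forall j, `|x j 0| <= 1) ->
  `|(map_mx intr S *m x) i 0| <= (max_row_norm1 S)%:R.
Proof.
move=> x1; rewrite mxE (le_trans (ler_norm_sum _ _ _)) //.
apply: (@le_trans _ _ (\sum_j `|S i j|%N)%:R); last first.
  by rewrite ler_nat; exact: (@leq_bigmax _ (fun i => \sum_j `|S i j|)%N i).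
rewrite natr_sum; apply: ler_sum => j _.
by rewrite normrM mxE -intr_norm -abszE -pmulrn ler_piMr.
Qed.

(** Rounding [x] down coordinatewise moves every [(A x)_j] by at most the
    largest row 1-norm, so the rounded point lies in the polyhedron and is [0];
    thus [x] itself is the rounding error. *)
Lemma lattice_free_rounding (R : realType) (m n : nat) (S : 'M[int]_(m, n))
    (u : 'cV[nat]_m) (x : 'cV[R]_n) (i : 'I_m) :
  polyhedron S u `&` integer_lattice R n = [set 0] ->
  (forall j, (map_mx intr S *m x) j 0 <= (u j 0)%:R - (max_row_norm1 S)%:R) ->
  (map_mx intr S *m x) i 0 <= (max_row_norm1 S)%:R.
Proof.
move=> hK xP; pose y : 'cV[R]_n := map_mx intr (\col_j Num.floor (x j 0)).
have close j : `|(map_mx intr S *m (x - y)) j 0| <= (max_row_norm1 S)%:R.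
  apply: row_norm1_bound => k; rewrite !mxE.
  rewrite ger0_norm ?subr_ge0 ?floor_le //.
  by rewrite lerBlDl -[X in _ + X]/1%:~R -intrD ltW // floorD1_gt.
have split j : (map_mx intr S *m x) j 0
    = (map_mx intr S *m y) j 0 + (map_mx intr S *m (x - y)) j 0.
  by rewrite -{1}(subrK y x) mulmxDr [LHS]mxE addrC.
have y0 : y = 0.
  suff : (polyhedron S u `&` integer_lattice R n) y by rewrite hK.
  split; last by exists (\col_j Num.floor (x j 0)).
  move=> j; rewrite /satisfies.
  have := xP j; rewrite split; have := close j; rewrite ler_norml => /andP[lo _].
  by lra.
by rewrite split y0 mulmx0 mxE add0r -{1}y0 (le_trans (ler_norm _)).
Qed.

Theorem theorem4p8 (R : realType) (m n : nat) (S : 'M[int]_(m, n))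
    (u : 'cV[nat]_m)
    (hK : polyhedron S u `&` integer_lattice R n = [set 0])
    (hirr : forall k : 'I_m,
       exists2 z : 'cV[R]_n, (relaxation S u k `&` integer_lattice R n) z & z != 0)
    (hdelta : min_subdet S <> 0%N) :
  forall i : 'I_m,
    0 <= (u i 0)%:R :> R /\
    (u i 0)%:R <= 2 * (max_row_norm1 S)%:R * (n%:R + 2)
                  * ((max_subdet S)%:R / (min_subdet S)%:R) :> R.
Proof.
move=> i; split; first exact: ler0n.
have lo0 : 0 < (min_subdet S)%:R :> R by rewrite ltr0n lt0n; apply/eqP.
have lohi : (min_subdet S)%:R <= (max_subdet S)%:R :> R.
  by rewrite ler_nat min_subdet_le_max.
set r := _ / _; have r1 : 1 <= r by rewrite ler_pdivlMr ?mul1r.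
set M : R := (max_row_norm1 S)%:R; have M0 : 0 <= M by rewrite ler0n.
pose A : 'M[R]_(m, n) := map_mx intr S.
have bndA : bounded_dependencies A r.
  move=> y J yA yJ cJ j k kJ; apply: (dependency_ratio _ lo0 lohi _ yA yJ cJ) => //.
    exact: min_subdet_neq0_leq hdelta.
  by move=> f; apply: rowsub_subdet_bounds.
pose U : 'cV[R]_m := \col_j (u j 0)%:R.
have UE j : U j 0 = (u j 0)%:R by rewrite mxE.
have [z [zrel zZ] zn0] := hirr i.
have zj j : j != i -> (A *m z) j 0 <= U j 0 by move=> /zrel; rewrite UE.
have zi : U i 0 < (A *m z) i 0.
  rewrite ltNge; apply: contra_neqN zn0 => zi.
  suff : (polyhedron S u `&` integer_lattice R n) z by rewrite hK.
  split=> // j; have [-> | /zrel //] := eqVneq j i.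
  by rewrite /satisfies -UE.
rewrite -UE; apply: (@le_trans _ _ (2 * M * n.+1%:R * r)).
  apply: right_hand_side_bound zj zi _ => // [j | x xP].
    by rewrite UE ler0n.
  by apply: (@lattice_free_rounding R m n S u x i hK) => j; rewrite -UE; apply: xP.
rewrite ler_wpM2r ?(le_trans _ r1) // ler_wpM2l ?mulr_ge0 //.
by rewrite -natrD ler_nat addn2.
Qed.
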